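(* Let $x,y$ be complex numbers (or indeterminates) and define $k(n,x,y)$ by $$K(z,x,y)=\sum_{n\ge 0}k(n,x,y)z^n=\frac{1}{\sqrt{(1-(x+y)z)^2-4xyz^2}}=\frac{1}{\sqrt{1-2(x+y)z+(x-y)^2z^2}}$$ (the formal power series with constant term $1$). Then for every integer $n>0$, $$\det\big(k(i+j,x,y)\big)_{i,j=0}^{n-1}=2^{n-1}(xy)^{\binom n2},$$ $$\det\big(k(i+j+1,x,y)\big)_{i,j=0}^{n-1}=2^{n-1}(xy)^{\binom n2}\,(x^n+y^n),$$ $$\det\big(k(i+j+2,x,y)\big)_{i,j=0}^{n-1}=2^{n-1}(xy)^{\binom n2}\Big(2(xy)^n+\sum_{j=1}^n (x^j+y^j)^2(xy)^{n-j}\Big).$$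
   Context: The last expression equals $2^{n-1}(xy)^{\binom n2}(xy)^n\big(2+\sum_{j=1}^n \frac{(x^j+y^j)^2}{(xy)^j}\big)$. *)

(* Defs.v *)
From HB Require Import structures.
From mathcomp Require Import all_boot all_order all_algebra.
From mathcomp Require Import ring.

Set Implicit Arguments.
Unset Strict Implicit.
Unset Printing Implicit Defensive.

Import GRing.Theory.
Local Open Scope ring_scope.

(* A formal power series over R is its coefficient sequence nat -> R.         *)
(* R is a commutative ring in which 2 is invertible, so that x and y may be   *)
(* complex numbers as well as indeterminates (R = C[x, y]).                   *)

Section FormalPowerSeries.
Variable R : comUnitRingType.
Implicit Types a b s : nat -> R.

Definition fps_one : nat -> R := fun n => (n == 0%N)%:R.

Definition fps_mul a b : nat -> R :=
  fun n => \sum_(i < n.+1) a i * b (n - i)%N.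

Definition fps_of_poly (p : {poly R}) : nat -> R := fun n => p`_n.

(* Coefficients 0, ..., n of the inverse of a; meaningful if a 0 is a unit. *)
Fixpoint fps_inv_coefs a n : seq R :=
  if n is m.+1 then
    let b := fps_inv_coefs a m in
    rcons b (- (a 0%N)^-1 * \sum_(i < m.+1) a i.+1 * b`_(m - i))
  else [:: (a 0%N)^-1].

Definition fps_inv a : nat -> R := fun n => (fps_inv_coefs a n)`_n.

(* Coefficients 0, ..., n of the square root of a with constant term 1;       *)
(* meaningful if a 0 = 1 and 2 is a unit.                                     *)
Fixpoint fps_sqrt_coefs a n : seq R :=
  if n is m.+1 then
    let s := fps_sqrt_coefs a m in
    rcons s ((a m.+1 - \sum_(i < m) s`_i.+1 * s`_(m - i)) / 2%:R)
  else [:: 1].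

Definition fps_sqrt a : nat -> R := fun n => (fps_sqrt_coefs a n)`_n.

Lemma size_fps_inv_coefs a n : size (fps_inv_coefs a n) = n.+1.
Proof. by elim: n => //= n IHn; rewrite size_rcons IHn. Qed.

Lemma size_fps_sqrt_coefs a n : size (fps_sqrt_coefs a n) = n.+1.
Proof. by elim: n => //= n IHn; rewrite size_rcons IHn. Qed.

Lemma nth_fps_inv_coefs a n i :
  (i <= n)%N -> (fps_inv_coefs a n)`_i = fps_inv a i.
Proof.
elim: n => [|n IHn]; first by rewrite leqn0 => /eqP->.
rewrite leq_eqVlt => /predU1P[-> //|lt_in].
by rewrite /= nth_rcons size_fps_inv_coefs lt_in IHn.
Qed.

Lemma nth_fps_sqrt_coefs a n i :
  (i <= n)%N -> (fps_sqrt_coefs a n)`_i = fps_sqrt a i.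
Proof.
elim: n => [|n IHn]; first by rewrite leqn0 => /eqP->.
rewrite leq_eqVlt => /predU1P[-> //|lt_in].
by rewrite /= nth_rcons size_fps_sqrt_coefs lt_in IHn.
Qed.

Lemma fps_invS a n :
  fps_inv a n.+1 =
    - (a 0%N)^-1 * \sum_(i < n.+1) a i.+1 * fps_inv a (n - i)%N.
Proof.
rewrite {1}/fps_inv /= nth_rcons size_fps_inv_coefs ltnn eqxx.
congr (_ * _); apply: eq_bigr => i _.
by rewrite nth_fps_inv_coefs // leq_subr.
Qed.

Lemma fps_sqrtS a n :
  fps_sqrt a n.+1 =
    (a n.+1 - \sum_(i < n) fps_sqrt a i.+1 * fps_sqrt a (n - i)%N) / 2%:R.
Proof.
rewrite {1}/fps_sqrt /= nth_rcons size_fps_sqrt_coefs ltnn eqxx.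
congr ((_ - _) / _); apply: eq_bigr => i _.
by rewrite !nth_fps_sqrt_coefs // leq_subr.
Qed.

Lemma fps_mulV a n :
  a 0%N \is a GRing.unit -> fps_mul a (fps_inv a) n = fps_one n.
Proof.
move=> Ua; case: n => [|n]; rewrite /fps_mul big_ord_recl.
  by rewrite big_ord0 addr0 divrr.
rewrite subn0 fps_invS mulrA mulrN divrr // mulN1r.
apply/eqP; rewrite addrC subr_eq0; apply/eqP.
by apply: eq_bigr => i _; rewrite /= subSS.
Qed.

Lemma fps_sqrt0 a : fps_sqrt a 0 = 1.
Proof. by []. Qed.

Lemma fps_mul_sqrt a n :
  2%:R \is a @GRing.unit R -> a 0%N = 1 ->
  fps_mul (fps_sqrt a) (fps_sqrt a) n = a n.
Proof.
move=> U2 a0; case: n => [|n]; rewrite /fps_mul big_ord_recl.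
  by rewrite big_ord0 addr0 mulr1 a0.
rewrite big_ord_recr /= subn0 subnn fps_sqrt0 mul1r mulr1.
rewrite addrCA -mulr2n -mulr_natr fps_sqrtS divrK //.
by rewrite addrCA; under eq_bigr do rewrite subSS; rewrite subrr addr0.
Qed.

Lemma fps_sqrt_unique a s :
  2%:R \is a @GRing.unit R -> s 0%N = 1 -> fps_mul s s =1 a ->
  s =1 fps_sqrt a.
Proof.
move=> U2 s0 sqs n; elim/ltn_ind: n => -[_|n IHn]; first by rewrite s0.
apply: (mulIr U2); rewrite fps_sqrtS divrK // -sqs /fps_mul.
rewrite big_ord_recl big_ord_recr /= subn0 subnn s0 mul1r mulr1.
rewrite addrCA -mulr2n.
rewrite (eq_bigr (fun i : 'I_n => fps_sqrt a i.+1 * fps_sqrt a (n - i)%N)).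
  by rewrite addrAC subrr add0r mulr_natr.
by move=> i _; rewrite subSS !IHn ?ltnS ?leq_subr //.
Qed.

Definition radicand (x y : R) : {poly R} :=
  (1 - (x + y) *: 'X) ^+ 2 - (4%:R * x * y) *: 'X^2.

Lemma radicandE (x y : R) :
  radicand x y = 1 - (2%:R * (x + y)) *: 'X + (x - y) ^+ 2 *: 'X^2.
Proof. by rewrite /radicand -!mul_polyC; ring. Qed.

Definition K (x y : R) : nat -> R :=
  fps_inv (fps_sqrt (fps_of_poly (radicand x y))).

Lemma fps_mul_K (x y : R) n :
  fps_mul (fps_sqrt (fps_of_poly (radicand x y))) (K x y) n = fps_one n.
Proof. by rewrite fps_mulV // fps_sqrt0 unitr1. Qed.

Lemma radicand_coef0 (x y : R) : fps_of_poly (radicand x y) 0 = 1.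
Proof.
rewrite /fps_of_poly radicandE !coefE /=.
by rewrite !mulr0 subr0 addr0.
Qed.

Definition k (n : nat) (x y : R) : R := K x y n.

End FormalPowerSeries.

(* Main.v *)
Require Import Defs.
From HB Require Import structures.
From mathcomp Require Import all_boot all_order all_algebra.
From mathcomp Require Import ring zify.

Set Implicit Arguments.
Unset Strict Implicit.
Unset Printing Implicit Defensive.

Import GRing.Theory.
Local Open Scope ring_scope.

(** Write [s = x + y], [p = x y] and [u = s + t + p / t].  The Laurent
    polynomials [T_0 = 1], [T_j = t^j + (p / t)^j] are orthogonal for the constant
    term functional, with norms [h_0 = 1], [h_j = 2 p^j].  If
    [u^n = \sum_j a(n, j) T_j], then [k n = a(n, 0)] is the constant term of
    [u^n], and the Hankel matrices factor through the unitriangular matrix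
    [A = (a(i, j))], the shifted matrix [A1 = (a(i + 1, j))] and [H = diag h]:
    they are [A H A^T], [A H A1^T] and [A1 H A1^T + h_n E_(n-1, n-1)].
    Since [u = (t + x) (t + y) / t] vanishes at [t = - x], where [T_j] equals
    [(-1)^j (x^j + y^j)] for [j > 0], Cramer's rule gives [det A1 = x^n + y^n].
    Expanding along the last corner yields
    [D_n = (\prod_(j < n) h_j) (x^n + y^n)^2 + h_n D_(n-1)] for the third
    family. *)

(** * The expansion table and the factorizations of the Hankel matrices *)

Section ChebyshevTable.
Variables (R : comUnitRingType) (s p : R).

(* [cheb n j] is the coefficient [a(n, j)] of [T_j] in [u^n]; the recurrence is
   [u T_j = T_(j+1) + s T_j + p T_(j-1)], with [2 p] in place of [p] for [j = 1]. *)
Fixpoint cheb (n j : nat) : R :=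
  if n is m.+1 then
    if j is l.+1 then cheb m l + s * cheb m l.+1 + p * cheb m l.+2
    else s * cheb m 0 + 2%:R * p * cheb m 1
  else (j == 0%N)%:R.

Definition cheb_norm (j : nat) : R := if j is 0 then 1 else 2%:R * p ^+ j.

Lemma cheb_small n j : (n < j)%N -> cheb n j = 0.
Proof.
elim: n j => [|n IHn] [|j] //= ltnj.
by rewrite !IHn ?mulr0 ?addr0 //; lia.
Qed.

Lemma cheb_diag n : cheb n n = 1.
Proof. by elim: n => //= n IHn; rewrite IHn !cheb_small ?mulr0 ?addr0. Qed.

(** Multiplication by [u] is self-adjoint for the constant term form; cutting the sums after [N]
    leaves one boundary term on each side. *)
Lemma cheb_sum_by_parts i j N :
  \sum_(l < N.+1) cheb i.+1 l * cheb_norm l * cheb j l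
    + cheb_norm N.+1 * cheb i N * cheb j N.+1
  = \sum_(l < N.+1) cheb i l * cheb_norm l * cheb j.+1 l
    + cheb_norm N.+1 * cheb i N.+1 * cheb j N.
Proof.
elim: N => [|N IHN]; first by rewrite !big_ord1 /= expr1; ring.
rewrite big_ord_recr [in RHS]big_ord_recr.
move: IHN; set S := \sum_(l < N.+1) _; set T := \sum_(l < N.+1) _.
by move/(canRL (addrK _)) => ->; rewrite /= !exprS; ring.
Qed.

Lemma cheb_shift i j N : (i <= N)%N -> (j <= N)%N ->
  \sum_(l < N.+1) cheb i.+1 l * cheb_norm l * cheb j l
  = \sum_(l < N.+1) cheb i l * cheb_norm l * cheb j.+1 l.
Proof.
move=> leiN lejN; have := cheb_sum_by_parts i j N.
by rewrite !(@cheb_small _ N.+1) // !(mulr0, mul0r, addr0).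
Qed.

Lemma cheb_sum_widen i M N (b : nat -> R) : (i < M <= N)%N ->
  \sum_(l < M) cheb i l * b l = \sum_(l < N) cheb i l * b l.
Proof.
case/andP=> ltiM; elim: N => [|N IHN]; first by lia.
rewrite leq_eqVlt => /predU1P[-> //|]; rewrite ltnS => leMN.
by rewrite big_ord_recr -IHN //= cheb_small ?mul0r ?addr0 //; lia.
Qed.

(** By orthogonality both sides are the constant term of [u^i u^j]. Factors [u] move from left to
    right until [i = 0]; this is done on a long range, and terms with [l > i] vanish. *)
Lemma cheb_gram i j M : (i < M)%N ->
  \sum_(l < M) cheb i l * cheb_norm l * cheb j l = cheb (i + j) 0.
Proof.
move=> ltiM.
suff gram_large N : (i + j <= N)%N ->
    \sum_(l < N.+1) cheb i l * cheb_norm l * cheb j l = cheb (i + j) 0.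
  rewrite -(gram_large (i + j + M)%N) ?leq_addr //.
  under eq_bigr do rewrite -mulrA; under [RHS]eq_bigr do rewrite -mulrA.
  by apply: (@cheb_sum_widen _ _ _ (fun l => cheb_norm l * cheb j l)); lia.
elim: {M ltiM} i j => [|i IHi] j leN.
  rewrite big_ord_recl big1 /= => [|l _]; first by rewrite mulr1 mul1r addr0.
  by rewrite !mul0r.
by rewrite cheb_shift ?IHi ?addSnnS //; lia.
Qed.

Definition cheb_mx n : 'M[R]_n := \matrix_(i, l) cheb i l.
Definition cheb_mx1 n : 'M[R]_n := \matrix_(i, l) cheb i.+1 l.
Definition cheb_norm_mx n : 'M[R]_n := diag_mx (\row_l cheb_norm l).

Lemma det_cheb_mx n : \det (cheb_mx n) = 1.
Proof.
rewrite det_trig ?big1 // => [i _|]; first by rewrite mxE cheb_diag.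
by apply/is_trig_mxP => i j ltij; rewrite mxE cheb_small.
Qed.

Lemma det_cheb_norm_mxS n :
  \det (cheb_norm_mx n.+1) = 2%:R ^+ n * p ^+ 'C(n.+1, 2).
Proof.
rewrite det_diag; under eq_bigr do rewrite mxE.
elim: n => [|n IHn]; first by rewrite big_ord1 mulr1.
rewrite big_ord_recr IHn [in RHS](binS n.+1) bin1 exprD /cheb_norm /=.
by rewrite !exprS; ring.
Qed.

Lemma cheb_hankel0 n :
  \matrix_(i < n, j < n) cheb (i + j) 0
  = cheb_mx n *m cheb_norm_mx n *m (cheb_mx n)^T.
Proof.
apply/matrixP=> i j; rewrite mul_mx_diag !mxE -(cheb_gram j (ltn_ord i)).
by apply: eq_bigr => l _; rewrite !mxE.
Qed.

Lemma cheb_hankel1 n :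
  \matrix_(i < n, j < n) cheb (i + j).+1 0
  = cheb_mx n *m cheb_norm_mx n *m (cheb_mx1 n)^T.
Proof.
apply/matrixP=> i j; rewrite mul_mx_diag !mxE -addnS -(cheb_gram j.+1 (ltn_ord i)).
by apply: eq_bigr => l _; rewrite !mxE.
Qed.

(** Row [i + 1] of the table reaches column [n + 1], one beyond the square matrix; that column is
    nonzero only in the last row, hence the corner term. *)
Lemma cheb_hankel2 n :
  \matrix_(i < n.+1, j < n.+1) cheb (i + j).+2 0
  = cheb_mx1 n.+1 *m cheb_norm_mx n.+1 *m (cheb_mx1 n.+1)^T
    + cheb_norm n.+1 *: delta_mx ord_max ord_max.
Proof.
apply/matrixP=> i j; rewrite mul_mx_diag [LHS]mxE -addSn -addnS.
rewrite -(@cheb_gram i.+1 j.+1 n.+2); last by rewrite !ltnS -ltnS.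
rewrite big_ord_recr !mxE; congr (_ + _).
  by apply: eq_bigr => l _; rewrite !mxE.
have corner (l : 'I_n.+1) : cheb l.+1 n.+1 = (l == ord_max)%:R.
  have [->|nel] := eqVneq l ord_max; first exact: cheb_diag.
  rewrite cheb_small //; move: nel (ltn_ord l).
  by rewrite -val_eqE /=; lia.
rewrite [ord_max in cheb _ ord_max]/= !corner.
by case: (i == _) (j == _) => [] []; rewrite /= ?(mulr0, mul0r, mulr1, mul1r).
Qed.

End ChebyshevTable.

(** * Evaluation of the determinants *)

Lemma det_add_corner (R : comNzRingType) n (M : 'M[R]_n.+1) c :
  \det (M + c *: delta_mx ord_max ord_max)
  = \det M + c * \det (row' ord_max (col' ord_max M)).
Proof.
set N := M + _.
have cofN j : cofactor N ord_max j = cofactor M ord_max j.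
  congr (_ * \det _); apply/matrixP=> i l.
  by rewrite !mxE eq_sym (negPf (neq_lift _ _)) mulr0 addr0.
rewrite (expand_det_row N ord_max) (expand_det_row M ord_max).
under eq_bigr => j _ do rewrite cofN /N !mxE eqxx mulrDl.
rewrite big_split; congr (_ + _).
rewrite (bigD1 ord_max) //= big1 ?addr0 => [|j /negPf nej].
  by rewrite eqxx mulr1 /cofactor addnn -signr_odd odd_double mul1r.
by rewrite nej mulr0 mul0r.
Qed.

Section HankelDeterminants.
Variables (R : comUnitRingType) (x y : R).
Let s := x + y.
Let p := x * y.
Let a := cheb s p.

(* [w j] is [T_j] evaluated at the zero [t = - x] of [u]. *)
Let w j : R := if j is 0 then 1 else (-1) ^+ j * (x ^+ j + y ^+ j).

(** The full sum is [u^(i+1)] at a zero of [u]; the omitted term has coefficient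
    [a i.+1 N.+1 = a i N]. *)
Lemma cheb_eval_root i N : (i <= N)%N ->
  \sum_(l < N.+1) a i.+1 l * w l = - (a i N * w N.+1).
Proof.
move=> leiN.
(* The sum telescopes by the three-term recurrence of [w]. It starts with two terms because [w 0] is
   1 and not 2. *)
suff partial M : \sum_(l < M.+2) a i.+1 l * w l
    = p * a i M.+2 * w M.+1 - a i M.+1 * w M.+2.
  case: N leiN => [|N] leiN.
    by rewrite big_ord1 /= /a /= (@cheb_small _ _ _ _ 1) // /s; ring.
  by rewrite partial /a cheb_small // mulr0 mul0r sub0r.
elim: M => [|M IHM].
  by rewrite !big_ord_recr big_ord0 /= -/a /s /p; ring.
by rewrite big_ord_recr IHM /= -/a /s /p !exprS; ring.
Qed.

Lemma det_cheb_mx1 n : \det (cheb_mx1 s p n.+1) = x ^+ n.+1 + y ^+ n.+1.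
Proof.
set A := cheb_mx1 s p n.+1.
pose v : 'cV[R]_n.+1 := \col_l w l.
have Av : A *m v = - w n.+1 *: delta_mx ord_max 0.
  apply/matrixP=> i j; rewrite !mxE ord1 eqxx andbT.
  under eq_bigr do rewrite !mxE.
  rewrite (cheb_eval_root (N := n)) -1?ltnS // mulNr mulrC; congr (- (_ * _)).
  have [->|nei] := eqVneq i ord_max; first exact: cheb_diag.
  rewrite /a cheb_small //; move: nei (ltn_ord i).
  by rewrite -val_eqE /=; lia.
(* Since [w 0 = 1], entry 0 of the right side is [\det A]. *)
have /matrixP/(_ 0 0) : \adj A *m (A *m v) = \det A *: v.
  by rewrite mulmxA mul_adj_mx mul_scalar_mx.
rewrite Av -scalemxAr -colE !mxE mulr1 => <-.
(* Without its last row and first column, [A] becomes unitriangular. *)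
have -> : cofactor A ord_max 0 = (-1) ^+ n.
  rewrite /cofactor addn0 det_trig ?big1 ?mulr1 // => [i _|].
    by rewrite !mxE lift_max lift0 cheb_diag.
  apply/is_trig_mxP => i j ltij.
  by rewrite !mxE lift_max lift0 cheb_small.
rewrite /= exprS mulN1r mulNr opprK mulrAC -exprD addnn -signr_odd odd_double.
by rewrite mul1r.
Qed.

Lemma det_hankel0 n :
  \det (\matrix_(i < n.+1, j < n.+1) a (i + j) 0)
  = 2%:R ^+ n * p ^+ 'C(n.+1, 2).
Proof.
by rewrite cheb_hankel0 !det_mulmx det_tr det_cheb_mx det_cheb_norm_mxS mul1r mulr1.
Qed.

Lemma det_hankel1 n :
  \det (\matrix_(i < n.+1, j < n.+1) a (i + j).+1 0)
  = 2%:R ^+ n * p ^+ 'C(n.+1, 2) * (x ^+ n.+1 + y ^+ n.+1).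
Proof.
rewrite cheb_hankel1 !det_mulmx det_tr det_cheb_mx det_cheb_norm_mxS mul1r.
by rewrite det_cheb_mx1.
Qed.

Lemma det_hankel2_rec n :
  \det (\matrix_(i < n.+1, j < n.+1) a (i + j).+2 0)
  = 2%:R ^+ n * p ^+ 'C(n.+1, 2) * (x ^+ n.+1 + y ^+ n.+1) ^+ 2
    + 2%:R * p ^+ n.+1 * \det (\matrix_(i < n, j < n) a (i + j).+2 0).
Proof.
rewrite [in LHS]cheb_hankel2 det_add_corner !det_mulmx det_tr det_cheb_mx1.
rewrite det_cheb_norm_mxS; congr (_ + _); first by ring.
(* In the minor [i + 1 < n + 1], so [n + 1] columns already give the full Gram sum and no corner
   term appears. *)
congr (_ * \det _); apply/matrixP=> i j.
rewrite mul_mx_diag !mxE -addSn -addnS.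
rewrite -[RHS](@cheb_gram _ s p i.+1 j.+1 n.+1) ?ltnS //.
by apply: eq_bigr => l _; rewrite !mxE !lift_max.
Qed.

Lemma det_hankel2 n :
  \det (\matrix_(i < n.+1, j < n.+1) a (i + j).+2 0)
  = 2%:R ^+ n * p ^+ 'C(n.+1, 2) *
      (2%:R * p ^+ n.+1
       + \sum_(1 <= j < n.+2) (x ^+ j + y ^+ j) ^+ 2 * p ^+ (n.+1 - j)).
Proof.
elim: n => [|n IHn]; rewrite det_hankel2_rec.
  by rewrite det_mx00 big_nat1 subnn; ring.
rewrite IHn [in RHS]big_nat_recr //= subnn expr0 mulr1.
have -> : \sum_(1 <= j < n.+2) (x ^+ j + y ^+ j) ^+ 2 * p ^+ (n.+2 - j)
    = p * \sum_(1 <= j < n.+2) (x ^+ j + y ^+ j) ^+ 2 * p ^+ (n.+1 - j).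
  rewrite mulr_sumr; apply: eq_big_nat => j /andP[_ ltj].
  by rewrite mulrCA -exprS -subSn.
set S := \sum_(1 <= j < n.+2) _.
by rewrite (binS n.+1) bin1 exprD !exprS; ring.
Qed.

End HankelDeterminants.

(** * The generating function, and [k] as the first column of the table *)

Section GeneratingFunction.
Variables (R : comUnitRingType) (s p : R).

Let step (F : {poly R}) := 'X * (1 + s%:P * F + p%:P * F ^+ 2).

(* Polynomial approximations of the power series solution [F] of
   [F = z (1 + s F + p F^2)], for which [1 - s z - 2 p z F] is the square root of
   the radicand; no division by [p] is involved. *)
Definition motzkin_approx m : {poly R} := iter m step 0.
Local Notation F := motzkin_approx.

(** [step] is an X-adic contraction: [step A - step B] is a multiple of ['X * (A - B)]. *)
Lemma motzkin_approxS m : exists E, F m.+1 = F m + 'X^(m.+1) * E.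
Proof.
have stepB A B : step A = step B + 'X * (A - B) * (s%:P + p%:P * (A + B)).
  by rewrite /step; ring.
elim: m => [|m [E IHm]]; first by exists 1; rewrite /F /= /step; ring.
exists (E * (s%:P + p%:P * (F m.+1 + F m))).
have dF : F m.+1 - F m = 'X^(m.+1) * E by rewrite IHm addrAC subrr add0r.
by rewrite [LHS](stepB (F m.+1) (F m)) dF -[step (F m)]/(F m.+1) [in RHS]exprS; ring.
Qed.

Lemma motzkin_approx_fix m :
  exists E, F m = 'X * (1 + s%:P * F m + p%:P * F m ^+ 2) + 'X^(m.+1) * E.
Proof.
have [E FE] := motzkin_approxS m; exists (- E).
by rewrite -[X in X + _]/(F m.+1) FE; ring.
Qed.

Definition sqrt_approx m : {poly R} :=
  1 - s%:P * 'X - 2%:R * p%:P * 'X * F m.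
Local Notation Q := sqrt_approx.

Lemma coef_sqrt_approx i m : (i <= m)%N -> (Q m)`_i = (Q i)`_i.
Proof.
elim: m => [|m IHm]; first by rewrite leqn0 => /eqP->.
rewrite leq_eqVlt => /predU1P[-> //|leim].
have [E FE] := motzkin_approxS m.
have -> : Q m.+1 = Q m + 'X^(m.+1) * (- 2%:R * p%:P * 'X * E).
  by rewrite /sqrt_approx FE; ring.
by rewrite coefD coefXnM leim addr0 IHm.
Qed.

(** Completes the square in the quadratic equation for [F], which holds modulo ['X^(m.+1)]. *)
Lemma sqr_sqrt_approx m : exists E,
  Q m ^+ 2 = (1 - s *: 'X) ^+ 2 - (4%:R * p) *: 'X^2 + 'X^(m.+1) * E.
Proof.
have [E FE] := motzkin_approx_fix m.
exists (- 4%:R * p%:P * 'X * E).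
have eqE : 'X^(m.+1) * E = F m - 'X * (1 + s%:P * F m + p%:P * F m ^+ 2).
  by rewrite {1}FE; ring.
rewrite mulrCA eqE.
by rewrite /sqrt_approx -!mul_polyC polyCM; ring.
Qed.

(* The columns [j] of the table have generating functions [G F^j] where [G]
   inverts [Q]: both sides obey the recurrence defining the table. *)
Lemma coef_motzkin_approx (G : {poly R}) N :
    (forall n, (n <= N)%N -> (Q N * G)`_n = (n == 0)%:R) ->
  forall n j, (n <= N)%N -> (G * F N ^+ j)`_n = cheb s p n j.
Proof.
move=> QG; have [E FE] := motzkin_approx_fix N.
have F0 : (F N)`_0 = 0 by rewrite FE coefD coefXM coefXnM addr0.
(* The definition of [Q], multiplied by [G], is the recurrence of column 0. *)
have GE : G = Q N * G + 'X * (s%:P * G + 2%:R * p%:P * (G * F N)).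
  by rewrite /sqrt_approx; ring.
elim=> [|n IHn] [|j] ltnN /=.
- by rewrite expr0 mulr1 GE coefD QG // coefXM addr0.
- by rewrite exprS mulrCA coef0M F0 mul0r.
- rewrite expr0 mulr1 GE coefD QG // add0r coefXM /= coefD -!polyCMn.
  rewrite -!polyCM !coefCM -(IHn 0%N (ltnW ltnN)) -(IHn 1%N (ltnW ltnN)).
  by rewrite expr0 mulr1 expr1.
have -> : G * F N ^+ j.+1 = 'X * (G * F N ^+ j + s%:P * (G * F N ^+ j.+1)
    + p%:P * (G * F N ^+ j.+2)) + 'X^(N.+1) * (E * G * F N ^+ j).
  by rewrite exprS {1}FE !exprS; ring.
by rewrite coefD coefXnM ltnS ltnN addr0 coefXM /= !coefD !coefCM !IHn // ltnW.
Qed.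

End GeneratingFunction.

Lemma k_cheb (R : comUnitRingType) (unit2 : 2%:R \is a @GRing.unit R)
  (x y : R) n : k n x y = cheb (x + y) (x * y) n 0.
Proof.
pose Q := sqrt_approx (x + y) (x * y).
(* Coefficient [i] of [Q m] is constant for [m >= i], so the diagonal is the limit series. *)
have sqrtQ : (fun i => (Q i)`_i) =1 fps_sqrt (fps_of_poly (radicand x y)).
  apply: fps_sqrt_unique => // [|m].
    by rewrite /Q /sqrt_approx mulr0 subr0 coefB coef1 coefCM coefX mulr0 subr0.
  have [E QE] := sqr_sqrt_approx (x + y) (x * y) m.
  have -> : fps_of_poly (radicand x y) m = (Q m ^+ 2)`_m.
    by rewrite QE coefD coefXnM ltnS leqnn addr0 mulrA.
  rewrite expr2 coefM; apply: eq_bigr => i _.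
  by rewrite [in RHS]coef_sqrt_approx -1?ltnS // [in RHS]coef_sqrt_approx ?leq_subr.
(* Cutting [K] after degree [n] keeps the coefficients of the product up to [n]. *)
pose G := \poly_(i < n.+1) K x y i.
rewrite -(@coef_motzkin_approx R (x + y) (x * y) G n _ n 0%N) //.
  by rewrite expr0 mulr1 coef_poly ltnSn.
move=> m lemn; rewrite -[RHS](fps_mul_K x y) coefM; apply: eq_bigr => i _.
rewrite -sqrtQ coef_sqrt_approx ?coef_poly; last by have := ltn_ord i; lia.
by rewrite ifT //; lia.
Qed.

Theorem theoremB (R : comUnitRingType) (unit2 : 2%:R \is a @GRing.unit R)
    (x y : R) (n : nat) (n_gt0 : (0 < n)%N) :
  [/\ \det (\matrix_(i < n, j < n) k (i + j) x y)
        = 2%:R ^+ (n - 1) * (x * y) ^+ 'C(n, 2),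
      \det (\matrix_(i < n, j < n) k (i + j + 1) x y)
        = 2%:R ^+ (n - 1) * (x * y) ^+ 'C(n, 2) * (x ^+ n + y ^+ n)
    & \det (\matrix_(i < n, j < n) k (i + j + 2) x y)
        = 2%:R ^+ (n - 1) * (x * y) ^+ 'C(n, 2) *
          (2%:R * (x * y) ^+ n
           + \sum_(1 <= j < n.+1) (x ^+ j + y ^+ j) ^+ 2 * (x * y) ^+ (n - j))].
Proof.
case: n n_gt0 => // n _; rewrite subn1; split.
- by rewrite -det_hankel0; congr (\det _); apply/matrixP=> i j; rewrite !mxE k_cheb.
- rewrite -det_hankel1; congr (\det _); apply/matrixP=> i j.
  by rewrite !mxE k_cheb // addn1.
rewrite -det_hankel2; congr (\det _); apply/matrixP=> i j.
by rewrite !mxE k_cheb // addn2.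
Qed.
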